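(* Let $\mathbf{A}$ be a finite, nontrivial solvable algebra that has a pointed cube term. Then $d_{\mathbf{A}}(n)\in\Theta(n)$. In fact, for every $n$ the algebra $\mathbf{A}^n$ is generated by those elements of $A^n$ that are constant with the possible exception of one component.
   Context: $d_{\mathbf{A}}(n)$ is the least size of a generating set of $\mathbf{A}^n$; $f\in\Theta(g)$ means there are constants $M_1,M_2,N>0$ with $M_1|g(x)|\le|f(x)|\le M_2|g(x)|$ for all $x>N$. Solvability is with respect to the term condition commutator. A pointed cube term is a term $F(x_1,\dots,x_m)$ for which there is a $k\times m$ matrix $M$ of variables and $p$ distinct constant symbols (naming elements of $A$), every column containing a symbol different from the variable $x$, such that $\mathbf{A}$ satisfies $F(M)\approx(x,\dots,x)^T$ ($F$ applied to each row of $M$ yields $x$). *)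

(* Defs.v *)
From Stdlib Require Import Rdefinitions Raxioms Rbasic_fun RIneq.
From Stdlib Require Import ClassicalEpsilon.
From HB Require Import structures.
From mathcomp Require Import all_boot.

Set Implicit Arguments.
Unset Strict Implicit.
Unset Printing Implicit Defensive.

Record signature := Signature { sym : Type; arity : sym -> nat }.

Record algebra (L : signature) := Algebra {
  carrier :> finType;
  ops : forall f : sym L, {ffun 'I_(arity f) -> carrier} -> carrier }.

Arguments ops {L} _ f _.

Inductive term (L : signature) (X : Type) : Type :=
  | Var : X -> term L X
  | App : forall f : sym L, ('I_(arity f) -> term L X) -> term L X.

Arguments Var {L X} _.
Arguments App {L X} f _.

Fixpoint eval_term (L : signature) (A : algebra L) (X : Type)
    (env : X -> A) (t : term L X) {struct t} : A :=
  match t with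
  | Var x => env x
  | App f ts => ops A f [ffun j => @eval_term L A X env (ts j)]
  end.

Arguments eval_term {L} A {X} env t.

Definition power_op (L : signature) (A : algebra L) (n : nat) (f : sym L)
    (args : {ffun 'I_(arity f) -> {ffun 'I_n -> A}}) : {ffun 'I_n -> A} :=
  [ffun i => ops A f [ffun j => args j i]].

Definition power_alg (L : signature) (A : algebra L) (n : nat) : algebra L :=
  @Algebra L {ffun 'I_n -> A} (@power_op L A n).

Definition subuniverse (L : signature) (B : algebra L) (S : {set B}) : Prop :=
  forall (f : sym L) (args : {ffun 'I_(arity f) -> B}),
    (forall j, args j \in S) -> ops B f args \in S.

Definition in_Sg (L : signature) (B : algebra L) (X : {set B}) (v : B) : Prop :=
  forall S : {set B}, X \subset S -> subuniverse S -> v \in S.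

Definition generates (L : signature) (B : algebra L) (X : {set B}) : Prop :=
  forall v : B, in_Sg X v.

Definition generatesb (L : signature) (B : algebra L) (X : {set B}) : bool :=
  if excluded_middle_informative (generates X) then true else false.

Lemma generates_setT (L : signature) (B : algebra L) : generates [set: B].
Proof. by move=> v S /subsetP H _; apply: H; rewrite in_setT. Qed.

Lemma exists_gen_size (L : signature) (A : algebra L) (n : nat) :
  exists m, [exists X : {set power_alg A n}, (#|X| == m) && generatesb X].
Proof.
exists #|[set: power_alg A n]|; apply/existsP; exists [set: power_alg A n].
rewrite eqxx /= /generatesb.
by case: excluded_middle_informative => // H; exfalso; apply: H; apply: generates_setT.
Qed.

Definition d_gen (L : signature) (A : algebra L) (n : nat) : nat :=
  ex_minn (exists_gen_size A n).

Definition BigTheta (f g : nat -> nat) : Prop :=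
  exists M1 M2 N : R,
    Rlt 0 M1 /\ Rlt 0 M2 /\ Rlt 0 N /\
    forall x : nat, Rlt N (INR x) ->
      Rle (Rmult M1 (Rabs (INR (g x)))) (Rabs (INR (f x))) /\
      Rle (Rabs (INR (f x))) (Rmult M2 (Rabs (INR (g x)))).

Definition congruence (L : signature) (A : algebra L) (th : A -> A -> Prop) : Prop :=
  (forall x, th x x) /\ (forall x y, th x y -> th y x) /\
  (forall x y z, th x y -> th y z -> th x z) /\
  (forall (f : sym L) (a b : {ffun 'I_(arity f) -> A}),
      (forall j, th (a j) (b j)) -> th (ops A f a) (ops A f b)).

Definition env2 (A : Type) (m k : nat) (a : 'I_m -> A) (b : 'I_k -> A)
    (s : 'I_m + 'I_k) : A :=
  match s with inl i => a i | inr j => b j end.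

Definition centralizes (L : signature) (A : algebra L)
    (alpha beta delta : A -> A -> Prop) : Prop :=
  forall (m k : nat) (t : term L ('I_m + 'I_k)%type)
         (a a' : 'I_m -> A) (b b' : 'I_k -> A),
    (forall i, alpha (a i) (a' i)) -> (forall j, beta (b j) (b' j)) ->
    delta (eval_term A (env2 a b) t) (eval_term A (env2 a b') t) ->
    delta (eval_term A (env2 a' b) t) (eval_term A (env2 a' b') t).

(* Term condition commutator [alpha, beta]: the least congruence delta with
   C(alpha, beta; delta), i.e. the intersection of all such congruences. *)
Definition tc_commutator (L : signature) (A : algebra L)
    (alpha beta : A -> A -> Prop) (x y : A) : Prop :=
  forall delta : A -> A -> Prop,
    congruence delta -> centralizes alpha beta delta -> delta x y.

Fixpoint derived (L : signature) (A : algebra L) (k : nat) : A -> A -> Prop :=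
  match k with
  | 0 => fun _ _ => True
  | k'.+1 => tc_commutator (@derived L A k') (@derived L A k')
  end.

Arguments derived {L} A k _ _.

Definition solvable (L : signature) (A : algebra L) : Prop :=
  exists k, forall x y : A, derived A k x y -> x = y.

(* Matrix entries: a variable (indexed by nat; variable 0 is x) or a constant
   symbol naming an element of A. *)
Definition entry_val (A : Type) (s : nat -> A) (e : nat + A) : A :=
  match e with inl v => s v | inr c => c end.

Definition pointed_cube_term (L : signature) (A : algebra L) (m : nat)
    (F : term L 'I_m) : Prop :=
  exists (k : nat) (M : 'I_k -> 'I_m -> (nat + A)%type),
    0 < k /\
    (forall j : 'I_m, exists i : 'I_k, M i j <> inl 0) /\
    (forall (s : nat -> A) (i : 'I_k),
        eval_term A (fun j => entry_val s (M i j)) F = s 0).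

Definition has_pointed_cube_term (L : signature) (A : algebra L) : Prop :=
  exists (m : nat) (F : term L 'I_m), pointed_cube_term A F.

Definition near_const (L : signature) (A : algebra L) (n : nat) :
    {set power_alg A n} :=
  [set v : power_alg A n | [exists c : A, forall i : 'I_n, forall j : 'I_n,
      ((v : {ffun 'I_n -> A}) i != c) ==> ((v : {ffun 'I_n -> A}) j != c) ==> (i == j)]].

(* Main.v *)
(** Let F be the pointed cube term with matrix M, and call a subset T of A
    absorbing if F(w) is in T as soon as, for some row r of M, w_j is in T at
    every position j where M_rj is the variable x.

    The key fact is that a nonempty absorbing subset of a finite solvable
    algebra is everything: one shows along the derived series that T meets
    every class of each term of the series.

    If S is a subalgebra of A^n containing the near-constant tuples and s is in
    S, then the values that may be put at coordinate i of s without leaving S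
    form an absorbing set; so S is closed under changing single coordinates and
    hence equals A^n.  This gives the linear upper bound.

    For the lower bound, work modulo the first derived congruence.  The values
    at a point x of the polynomials m(-, z) with m(u, d) = u for some parameters
    d also form an absorbing set, so these "translations" are transitive.  With
    the term condition this forces a k-ary term to be determined, modulo the
    congruence, by its values at the tuples equal to a fixed element o in all
    but one place.  So k generators yield at most |A|^(k|A|+1) elements of
    {a, b}^n when a and b are not congruent, whereas all 2^n must occur. *)

From Stdlib Require Import Reals ClassicalEpsilon.
Require Import Defs.
From mathcomp Require Import all_boot.

Set Implicit Arguments.
Unset Strict Implicit.
Unset Printing Implicit Defensive.

(** * Choice, evaluation and substitution of terms *)

Definition decide (P : Prop) : bool :=
  if excluded_middle_informative P then true else false.

Lemma decideP (P : Prop) : reflect P (decide P).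
Proof. by rewrite /decide; case: excluded_middle_informative => ?; constructor. Qed.

Lemma fun_choice (I B : Type) (P : I -> B -> Prop) :
  (forall i, exists b, P i b) -> exists f : I -> B, forall i, P i (f i).
Proof.
move=> H; exists (fun i => proj1_sig (constructive_indefinite_description _ (H i))).
by move=> i; case: constructive_indefinite_description.
Qed.

Lemma eval_ext (L : signature) (A : algebra L) (X : Type) (e e' : X -> A)
    (t : term L X) : e =1 e' -> eval_term A e t = eval_term A e' t.
Proof.
move=> He; elim: t => [x|f ts IH] /=; first exact: He.
by congr (ops A f _); apply/ffunP=> j; rewrite !ffunE IH.
Qed.

Fixpoint subst (L : signature) (X Y : Type) (s : X -> term L Y)
    (t : term L X) {struct t} : term L Y :=
  match t with
  | Var x => s x
  | App f ts => App f (fun j => @subst L X Y s (ts j))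
  end.

Lemma eval_subst (L : signature) (A : algebra L) (X Y : Type)
    (s : X -> term L Y) (e : Y -> A) (t : term L X) :
  eval_term A e (subst s t) = eval_term A (fun x => eval_term A e (s x)) t.
Proof.
elim: t => [x|f ts IH] //=.
by congr (ops A f _); apply/ffunP=> j; rewrite !ffunE IH.
Qed.

Lemma eval_power (L : signature) (A : algebra L) (n : nat) (X : Type)
    (e : X -> {ffun 'I_n -> A}) (t : term L X) (i : 'I_n) :
  (eval_term (power_alg A n) e t : {ffun 'I_n -> A}) i
    = eval_term A (fun x => e x i) t.
Proof.
elim: t => [x|f ts IH] //=.
rewrite /power_op ffunE; congr (ops A f _).
by apply/ffunP=> j; rewrite !ffunE IH.
Qed.

Lemma eval_congruence (L : signature) (A : algebra L) (th : A -> A -> Prop)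
    (X : Type) (e e' : X -> A) (t : term L X) :
  congruence th -> (forall x, th (e x) (e' x)) ->
  th (eval_term A e t) (eval_term A e' t).
Proof.
move=> [_ [_ [_ Hop]]] He; elim: t => [x|f ts IH] /=; first exact: He.
by apply: Hop => j; rewrite !ffunE; apply: IH.
Qed.

Lemma eval_subuniverse (L : signature) (B : algebra L) (S : {set B})
    (X : Type) (e : X -> B) (t : term L X) :
  subuniverse S -> (forall x, e x \in S) -> eval_term B e t \in S.
Proof.
move=> HS He; elim: t => [x|f ts IH] /=; first exact: He.
by apply: HS => j; rewrite ffunE; apply: IH.
Qed.

(** * The term condition and the derived series *)

Definition env_sum (A X Y : Type) (a : X -> A) (b : Y -> A) (v : X + Y) : A :=
  match v with inl x => a x | inr y => b y end.

Lemma centralizes_fin (L : signature) (A : algebra L)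
    (al be de : A -> A -> Prop) (X Y : finType) (t : term L (X + Y)%type)
    (a a' : X -> A) (b b' : Y -> A) :
  centralizes al be de ->
  (forall x, al (a x) (a' x)) -> (forall y, be (b y) (b' y)) ->
  de (eval_term A (env_sum a b) t) (eval_term A (env_sum a b') t) ->
  de (eval_term A (env_sum a' b) t) (eval_term A (env_sum a' b') t).
Proof.
move=> HC Ha Hb.
pose u := subst (fun v : X + Y => match v with
  | inl x => Var (inl (enum_rank x)) : term L ('I_#|X| + 'I_#|Y|)%type
  | inr y => Var (inr (enum_rank y)) end) t.
have E (c : X -> A) (d : Y -> A) : eval_term A (env_sum c d) t =
    eval_term A (env2 (fun i => c (enum_val i)) (fun i => d (enum_val i))) u.
  by rewrite eval_subst; apply: eval_ext => -[x|y] /=; rewrite enum_rankK.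
by rewrite !E; apply: HC.
Qed.

Lemma congruence_tc_commutator (L : signature) (A : algebra L)
    (al be : A -> A -> Prop) : congruence (tc_commutator al be).
Proof.
split; first by move=> x de [H _] _; apply: H.
split; first by move=> x y H de Hde Hc; apply: (Hde.2.1); apply: H.
split.
  by move=> x y z H1 H2 de Hde Hc; apply: (Hde.2.2.1) (H1 _ Hde Hc) (H2 _ Hde Hc).
move=> f a b H de Hde Hc; apply: (Hde.2.2.2) => j; exact: H.
Qed.

Lemma congruence_derived (L : signature) (A : algebra L) (k : nat) :
  congruence (derived A k).
Proof. by case: k => [|k] //; apply: congruence_tc_commutator. Qed.

Lemma centralizes_tc_commutator (L : signature) (A : algebra L)
    (al be : A -> A -> Prop) : centralizes al be (tc_commutator al be).
Proof.
move=> m k t a a' b b' Ha Hb H de Hde Hc.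
by apply: (Hc _ _ _ _ _ _ _ Ha Hb); apply: H.
Qed.

(** Once a term of the series is full, the next one is again the commutator of the full relation
    with itself. *)
Lemma derived1_full (L : signature) (A : algebra L) :
  (forall x y, derived A 1 x y) -> forall k x y, derived A k x y.
Proof.
move=> H1; elim=> [|k IH] // x y de Hde Hc; apply: (H1 x y de Hde).
by move=> m q t a a' b b' _ _; apply: Hc => i; apply: IH.
Qed.

(** * Absorbing sets in solvable algebras *)

Definition absorbing (L : signature) (A : algebra L) (m k : nat)
    (F : term L 'I_m) (M : 'I_k -> 'I_m -> (nat + A)%type) (T : {set A}) : Prop :=
  forall (r : 'I_k) (w : 'I_m -> A),
    (forall j, M r j = inl 0 -> w j \in T) -> eval_term A w F \in T.

(* The polynomial z |-> tau(F(..., z, ...)) with z at position [j], the other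
   arguments of [F] being new parameters. *)
Definition plug (L : signature) (m : nat) (F : term L 'I_m) (X : Type)
    (tau : term L (X + unit)%type) (j : 'I_m) : term L ((X + 'I_m) + unit)%type :=
  subst (fun v : X + unit => match v with
    | inl x => Var (inl (inl x))
    | inr _ => subst (fun l => if l == j then Var (inr tt) else Var (inl (inr l))) F
    end) tau.

Definition poly1 (L : signature) (A : algebra L) (X : Type)
    (tau : term L (X + unit)%type) (s : X -> A) (z : A) : A :=
  eval_term A (env_sum s (fun _ => z)) tau.

Lemma poly1_plug (L : signature) (A : algebra L) (m : nat) (F : term L 'I_m)
    (X : Type) (tau : term L (X + unit)%type) (j : 'I_m) (s : X -> A)
    (q : 'I_m -> A) (z : A) :
  poly1 (plug F tau j) (env_sum s q) z
    = poly1 tau s (eval_term A (fun l => if l == j then z else q l) F).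
Proof.
rewrite /poly1 /plug eval_subst; apply: eval_ext => -[x|u] //=.
by rewrite eval_subst; apply: eval_ext => l; case: (l == j).
Qed.

(* Here [s] holds the original parameters of a unary polynomial p and [s'] a
   modification of them, giving p'.  If p'(y) = p'(t) with t in T and [al t y],
   the term condition transfers this to p.  Otherwise write y = F(row y) and
   treat each argument in the context p(F(..., _, ...)), where the other
   arguments are modified to lie in T.  The modified context maps into p'(T), so
   its image on the [al]-class omits p'(y) and is strictly smaller than that of
   p', which bounds the recursion. *)
Lemma absorbing_context (L : signature) (A : algebra L) (m k : nat)
    (F : term L 'I_m) (M : 'I_k -> 'I_m -> (nat + A)%type) (r0 : 'I_k)
    (T : {set A}) (al de : A -> A -> Prop) :
  (forall j, exists i, M i j <> inl 0) ->
  (forall y, eval_term A (fun j => entry_val (fun _ => y) (M r0 j)) F = y) ->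
  absorbing F M T -> congruence al -> congruence de -> centralizes al al de ->
  (forall y, exists t, t \in T /\ al t y) ->
  forall N (X : finType) (tau : term L (X + unit)%type) (s s' : X -> A) (y : A),
    (forall x, al (s' x) (s x)) ->
    #|poly1 tau s' @: [set z | decide (al z y)]| < N ->
    exists t, [/\ t \in T, al t y & de (poly1 tau s t) (poly1 tau s y)].
Proof.
move=> Hcol Hrow HT Hal Hde HC Hmeet.
have [a Ha] := fun_choice Hmeet.
have [al_r [al_s [al_t al_op]]] := Hal.
have [de_r [de_s [de_t de_op]]] := Hde.
elim=> [|N IH] X tau s s' y Hs //.
set C := [set z | decide (al z y)]; rewrite ltnS => HN.
have [/imsetP[t]|Hn] := boolP (poly1 tau s' y \in poly1 tau s' @: (T :&: C)).
  rewrite !inE => /andP[tT /decideP aty] E; exists t; split=> //.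
  apply: (centralizes_fin HC (a := s')) => //.
  by change (de (poly1 tau s' t) (poly1 tau s' y)); rewrite E.
pose row j := entry_val (fun _ => y) (M r0 j).
have step (j : 'I_m) : exists t, [/\ t \in T, al t (row j) &
    de (poly1 (plug F tau j) (env_sum s row) t)
       (poly1 (plug F tau j) (env_sum s row) (row j))].
  apply: (IH _ _ _ (env_sum s' (fun l => a (row l)))).
    by move=> [x|l] /=; [apply: Hs | apply: (Ha _).2].
  apply: leq_trans HN; apply: proper_card; apply/properP; split.
    apply/subsetP=> v /imsetP[z]; rewrite inE => /decideP Hz ->.
    rewrite poly1_plug; apply: imset_f; rewrite inE; apply/decideP.
    rewrite -[X in al _ X]Hrow; apply: eval_congruence => // l.
    by case: eqP => [->|_] //; apply: (Ha _).2.
  exists (poly1 tau s' y); first by apply: imset_f; rewrite inE; apply/decideP.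
  apply: contra Hn => /imsetP[z]; rewrite inE => /decideP Hz E.
  rewrite E poly1_plug; apply: imset_f; rewrite !inE; apply/andP; split.
    (* Row [i] does not have the variable x in column [j], so its x-positions hold elements
       [a (row l)] of [T], whatever [z] is. *)
    have [i Hi] := Hcol j; apply: (HT i) => l Hl.
    by case: eqP => [lj|_]; [rewrite lj in Hl | apply: (Ha _).1].
  apply/decideP; rewrite -[X in al _ X]Hrow; apply: eval_congruence => // l.
  by case: eqP => [->|_] //; apply: (Ha _).2.
have [t Ht] := fun_choice step.
have tT j : t j \in T by have [] := Ht j.
have tal j : al (t j) (row j) by have [] := Ht j.
exists (eval_term A t F); split.
- by apply: (HT r0).
- by rewrite -[X in al _ X]Hrow; apply: eval_congruence.
(* The arguments of [F] pass from [row] to [t] one at a time; the term condition carries each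
   [Ht j], obtained with parameters [row], over to the parameters [mix i]. *)
pose mix i (l : 'I_m) := if l < i then t l else row l.
have E i : i <= m -> de (poly1 tau s (eval_term A (mix i) F)) (poly1 tau s y).
  elim: i => [|i IHi] im.
    by rewrite (eval_ext (e' := row) F) // Hrow.
  apply: de_t (IHi (ltnW im)).
  pose j := Ordinal im.
  have [_ _ Hj] := Ht j.
  have Hmix u v : (forall l, (if l == j then u else mix i l) = v l) ->
      poly1 (plug F tau j) (env_sum s (mix i)) u = poly1 tau s (eval_term A v F).
    by move=> H; rewrite poly1_plug; congr poly1; apply: eval_ext.
  rewrite -(Hmix (t j)); last first.
    move=> l; rewrite /mix ltnS; case: eqP => [-> /=|/eqP lj]; first by rewrite leqnn.
    by rewrite [l <= i]leq_eqVlt -(inj_eq val_inj) /= in lj *; rewrite (negPf lj).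
  rewrite -(Hmix (row j)); last first.
    by move=> l; rewrite /mix; case: eqP => [->|//]; rewrite ltnn.
  apply: (centralizes_fin HC (a := env_sum s row)) Hj => // -[x|l] //=.
  by rewrite /mix; case: ifP => _ //; apply: al_s.
have := E m (leqnn m); rewrite (eval_ext (e' := t) F) // => l.
by rewrite /mix ltn_ord.
Qed.

Lemma absorbing_full (L : signature) (A : algebra L) (m k : nat)
    (F : term L 'I_m) (M : 'I_k -> 'I_m -> (nat + A)%type) (T : {set A}) (x0 : A) :
  solvable A -> 0 < k -> (forall j, exists i, M i j <> inl 0) ->
  (forall (s : nat -> A) (i : 'I_k),
     eval_term A (fun j => entry_val s (M i j)) F = s 0) ->
  absorbing F M T -> x0 \in T -> forall x, x \in T.
Proof.
move=> [d Hd] k0 Hcol Hrow HT x0T.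
have meet i : forall y, exists t, t \in T /\ derived A i t y.
  elim: i => [|i IH] y; first by exists x0.
  have Hc : centralizes (derived A i) (derived A i) (derived A i.+1).
    exact: centralizes_tc_commutator.
  (* For the identity polynomial without parameters, the conclusion says that [T] meets the class of
     [y] one level further down. *)
  have [] := @absorbing_context L A m k F M (Ordinal k0) T _ _ Hcol
    (fun y => Hrow (fun _ => y) _) HT (congruence_derived A i)
    (congruence_derived A i.+1) Hc IH _ void (Var (inr tt))
    (fun v => match v with end) (fun v => match v with end) y _ (ltnSn _).
    by case.
  by move=> t [tT _ Ht]; exists t.
by move=> x; have [t [tT /Hd <-]] := meet d x.
Qed.

(** * Near-constant tuples generate the power *)

Definition upd (A : Type) (n : nat) (s : {ffun 'I_n -> A}) (i : 'I_n) (x : A) :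
    {ffun 'I_n -> A} := [ffun l => if l == i then x else s l].

Lemma upd_const_near (L : signature) (A : algebra L) (n : nat) (c x : A)
    (i : 'I_n) : (upd [ffun _ => c] i x : power_alg A n) \in near_const A n.
Proof.
rewrite inE; apply/existsP; exists c; apply/forallP=> l; apply/forallP=> l'.
by rewrite !ffunE; do 2![case: (_ =P i) => [->|_]]; rewrite ?eqxx ?implybT.
Qed.

Lemma near_const_generates (L : signature) (A : algebra L) (n : nat) (c : A) :
  solvable A -> has_pointed_cube_term A -> generates (near_const A n).
Proof.
move=> Hsol [m [F [k [M [k0 [Hcol Hrow]]]]]] v S /subsetP Hnear HS.
have upd_closed (s : power_alg A n) (i : 'I_n) (x : A) :
    s \in S -> (upd s i x : power_alg A n) \in S.
  move=> sS.
  pose T := [set x | (upd s i x : power_alg A n) \in S].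
  suff : x \in T by rewrite inE.
  apply: (@absorbing_full L A m k F M T (s i)) => //; last first.
    rewrite inE; suff -> : upd s i (s i) = s by [].
    by apply/ffunP=> l; rewrite ffunE; case: eqP => // ->.
  move=> r w Hw; rewrite inE.
  (* At coordinate [i] the arguments are [w]; at any other [l] they form row [r] of [M] with x read
     as [s l] and other variables as [c], so [F] returns [s l]. *)
  pose e j : power_alg A n := if M r j == inl 0 :> (nat + A)%type then upd s i (w j)
    else upd [ffun _ => entry_val (fun _ => c) (M r j)] i (w j).
  suff -> : (upd s i (eval_term A w F) : power_alg A n) = eval_term (power_alg A n) e F.
    apply: eval_subuniverse => // j; rewrite /e; case: eqP => [/Hw|_].
      by rewrite inE.
    by apply: Hnear; apply: upd_const_near.
  apply/ffunP=> l; rewrite eval_power ffunE; case: eqP => [->|li].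
    by apply: eval_ext => j; rewrite /e; case: ifP => _; rewrite ffunE eqxx.
  rewrite -[LHS](Hrow (fun v => if v == 0 then s l else c) r).
  apply: eval_ext => j; rewrite /e; case: eqP => [->|ne] /=.
    by rewrite ffunE; case: eqP li.
  rewrite !ffunE; case: eqP li => // _ _.
  by case: (M r j) ne => [[|p]|b].
have E i : i <= n -> ([ffun l : 'I_n => if l < i then (v : {ffun 'I_n -> A}) l else c]
    : power_alg A n) \in S.
  elim: i => [|i IH] le_in.
    apply: Hnear; rewrite inE; apply/existsP; exists c.
    by apply/forallP=> l; apply/forallP=> l'; rewrite !ffunE eqxx.
  have := upd_closed _ (Ordinal le_in) ((v : {ffun 'I_n -> A}) (Ordinal le_in)) (IH (ltnW le_in)).
  congr (_ \in S); apply/ffunP=> l; rewrite !ffunE ltnS.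
  case: eqP => [->|/eqP ne] /=; first by rewrite leqnn.
  by rewrite [l <= i]leq_eqVlt -(inj_eq val_inj) /= in ne *; rewrite (negPf ne).
have := E n (leqnn n); congr (_ \in S).
by apply/ffunP=> l; rewrite ffunE ltn_ord.
Qed.

(** * Translations and the lower bound *)

Lemma generates_term (L : signature) (B : algebra L) (X : {set B}) (v : B) :
  generates X ->
  exists t : term L 'I_#|X|, eval_term B (fun i => enum_val i) t = v.
Proof.
move=> /(_ v [set u | decide (exists t : term L 'I_#|X|,
  eval_term B (fun i => enum_val i) t = u)]).
rewrite inE => H; apply/decideP; apply: H.
  apply/subsetP=> u uX; rewrite inE; apply/decideP.
  by exists (Var (enum_rank_in uX u)); rewrite /= enum_rankK_in.
move=> f args Hargs; rewrite inE; apply/decideP.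
have Hts j : exists t : term L 'I_#|X|, eval_term B (fun i => enum_val i) t = args j.
  by apply/decideP; have := Hargs j; rewrite inE.
have [ts E] := fun_choice Hts.
exists (App f ts) => /=; congr (ops B f _).
by apply/ffunP=> j; rewrite ffunE E.
Qed.

(* Every parameter carries both its values: [snd] makes the polynomial the
   identity, [fst] makes it act.  Indexing the parameters by [A * A] lets
   arbitrarily many such polynomials be substituted into one term without
   renaming variables. *)
Definition moves (L : signature) (A : algebra L) (x x' : A) : Prop :=
  exists m : term L ((A * A) + unit)%type,
    (forall u, poly1 m snd u = u) /\ poly1 m fst x = x'.

(** The points reachable from [x] form an absorbing set: substitute into [F] the given polynomials
    at the x-positions of the row, and elsewhere a parameter that [snd] reads as the row entry and
    [fst] as [w j]. *)
Lemma moves_total (L : signature) (A : algebra L) (x x' : A) :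
  solvable A -> has_pointed_cube_term A -> moves x x'.
Proof.
move=> Hsol [m [F [k [M [k0 [Hcol Hrow]]]]]].
suff : x' \in [set z | decide (moves x z)] by rewrite inE => /decideP.
apply: (@absorbing_full L A m k F M _ x) => //; last first.
  by rewrite inE; apply/decideP; exists (Var (inr tt)).
move=> r w Hw; rewrite inE; apply/decideP.
have H j : exists p : term L ((A * A) + unit)%type,
    (forall u, poly1 p snd u = entry_val (fun v => if v == 0 then u else x) (M r j))
    /\ poly1 p fst x = w j.
  case E: (M r j) => [[|v]|c] /=.
  - by have := Hw j E; rewrite inE => /decideP.
  - by exists (Var (inl (w j, x))).
  - by exists (Var (inl (w j, c))).
have [p Hp] := fun_choice H.
exists (subst p F); split=> [u|].
  rewrite /poly1 eval_subst -[RHS](Hrow (fun v => if v == 0 then u else x) r).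
  by apply: eval_ext => j; apply: (Hp j).1.
by rewrite /poly1 eval_subst; apply: eval_ext => j; apply: (Hp j).2.
Qed.

(** Term condition for [m] composed with [t]: at [s] the arguments ([fst], [o]) and ([snd], [y])
    give equal values, so at [s'] they give congruent ones. *)
Lemma move_transfer (L : signature) (A : algebra L) (de : A -> A -> Prop)
    (X : finType) (m : term L ((A * A) + unit)%type) (t : term L (X + unit)%type)
    (s s' : X -> A) (o y : A) :
  congruence de -> centralizes (fun _ _ => True) (fun _ _ => True) de ->
  (forall u, poly1 m snd u = u) ->
  poly1 m fst (poly1 t s o) = poly1 t s y ->
  de (poly1 m fst (poly1 t s' o)) (poly1 t s' y).
Proof.
move=> Hde HC Hm E.
pose phi : term L (X + ((A * A) + unit))%type := subst (fun v => match v with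
  | inl ab => Var (inr (inl ab))
  | inr _ => subst (fun w => match w with
     | inl x => Var (inl x) | inr _ => Var (inr (inr tt)) end) t end) m.
have Ephi q b z : eval_term A (env_sum q (env_sum b (fun _ => z))) phi
    = poly1 m b (poly1 t q z).
  rewrite /phi eval_subst; apply: eval_ext => -[ab|u] //=.
  by rewrite eval_subst; apply: eval_ext => -[x'|[]].
have := @centralizes_fin L A _ _ de X _ phi s s' (env_sum fst (fun _ => o))
  (env_sum snd (fun _ => y)) HC (fun _ => I) (fun _ => I).
by rewrite !Ephi !Hm E; apply; apply: Hde.1.
Qed.

Definition point (I : eqType) (A : Type) (o : A) (i : I) (y : A) (l : I) : A :=
  if l == i then y else o.

(** Change the places from [o] to [y] in turn. A move that accounts for changing place [j] of the
    all-[o] tuple accounts for it modulo [de] whatever fills the other places, and [t] and [t'] can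
    share this move. *)
Lemma term_determined (L : signature) (A : algebra L) (de : A -> A -> Prop)
    (k : nat) (t t' : term L 'I_k) (o : A) (y : 'I_k -> A) :
  solvable A -> has_pointed_cube_term A ->
  congruence de -> centralizes (fun _ _ => True) (fun _ _ => True) de ->
  eval_term A (fun _ => o) t = eval_term A (fun _ => o) t' ->
  (forall i z, eval_term A (point o i z) t = eval_term A (point o i z) t') ->
  de (eval_term A y t) (eval_term A y t').
Proof.
move=> Hsol Hcube Hde HC E0 E1.
have [de_r [de_s [de_t de_op]]] := Hde.
pose w i (l : 'I_k) := if l < i then y l else o.
suff : de (eval_term A (w k) t) (eval_term A (w k) t').
  by rewrite !(eval_ext (e := w k) (e' := y)) // => l; rewrite /w ltn_ord.
suff H i : i <= k -> de (eval_term A (w i) t) (eval_term A (w i) t') by apply: H.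
elim: i => [|i IH] le_ik; first by rewrite /w /= E0; apply: de_r.
pose j := Ordinal le_ik.
have [m [Hm Em]] := moves_total (eval_term A (fun _ => o) t)
  (eval_term A (point o j (y j)) t) Hsol Hcube.
pose split_j (u : term L 'I_k) : term L ('I_k + unit)%type :=
  subst (fun l => if l == j then Var (inr tt) else Var (inl l)) u.
have Esplit u q z v : (forall l, (if l == j then z else q l) = v l) ->
    poly1 (split_j u) q z = eval_term A v u.
  move=> H; rewrite /poly1 eval_subst; apply: eval_ext => l.
  by rewrite -H; case: (l == j).
have Ew0 l : (if l == j then o else w i l) = w i l.
  by rewrite /w; case: eqP => [->|//]; rewrite ltnn.
have Ew1 l : (if l == j then y j else w i l) = w i.+1 l.
  rewrite /w ltnS; case: eqP => [->|/eqP ne] /=; first by rewrite leqnn.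
  by rewrite [l <= i]leq_eqVlt -(inj_eq val_inj) /= in ne *; rewrite (negPf ne).
have Eo l : (if l == j then o else o) = o by case: eqP.
have step u : eval_term A (fun _ => o) u = eval_term A (fun _ => o) t ->
    eval_term A (point o j (y j)) u = eval_term A (point o j (y j)) t ->
    de (poly1 m fst (eval_term A (w i) u)) (eval_term A (w i.+1) u).
  move=> U0 U1; rewrite -(Esplit _ _ _ _ Ew0) -(Esplit _ _ _ _ Ew1).
  apply: (@move_transfer L A de _ m _ (fun _ => o)) => //.
  by rewrite (Esplit _ _ _ _ Eo) (Esplit _ _ _ (point o j (y j))) // U0 U1.
apply: (de_t _ _ _ (de_s _ _ (step t erefl erefl))).
apply: (de_t _ _ _ _ (step t' (esym E0) (esym (E1 _ _)))).
by apply: eval_congruence => // -[ab|u] //=; apply: IH (ltnW le_ik).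
Qed.

Lemma abelian_quotient (L : signature) (A : algebra L) :
  1 < #|A| -> solvable A ->
  exists (de : A -> A -> Prop) (a b : A),
    [/\ congruence de, centralizes (fun _ _ => True) (fun _ _ => True) de & ~ de a b].
Proof.
move=> /card_gt1P [x [y [_ _ /eqP xy]]] [k Hk].
apply: NNPP => H; apply: xy; apply: (Hk).
apply: derived1_full => a b; apply: NNPP => Hab; apply: H.
exists (derived A 1), a, b; split=> //; first exact: congruence_derived.
exact: centralizes_tc_commutator.
Qed.

Lemma generators_lower_bound (L : signature) (A : algebra L) (n : nat)
    (X : {set power_alg A n}) :
  1 < #|A| -> solvable A -> has_pointed_cube_term A -> generates X ->
  n <= #|A| * (#|A| * #|X|).+1.
Proof.
move=> HA Hsol Hcube HX.
have [de [a [b [Hde HC Hab]]]] := abelian_quotient HA Hsol.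
pose vec (f : {ffun 'I_n -> bool}) : power_alg A n := [ffun i => if f i then a else b].
have [t Ht] := fun_choice (fun f => generates_term (vec f) HX).
(* These values determine the term modulo [de], hence each [f i], as [a] and [b] are not
   congruent. *)
pose code f : (A * {ffun 'I_#|X| * A -> A})%type :=
  (eval_term A (fun _ => a) (t f), [ffun p => eval_term A (point a p.1 p.2) (t f)]).
have code_inj : injective code.
  move=> f g [E0 /ffunP E1]; apply/ffunP=> i.
  have := @term_determined L A de _ (t f) (t g) a
    (fun l => (enum_val l : {ffun 'I_n -> A}) i) Hsol Hcube Hde HC E0.
  rewrite -!eval_power !Ht !ffunE => H.
  have {}H : de (if f i then a else b) (if g i then a else b).
    by apply: H => l z; have := E1 (l, z); rewrite !ffunE.
  by case: (f i) (g i) H => -[] // /(Hde.2.1).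
have := leq_card code code_inj.
rewrite card_prod !card_ffun card_prod !card_ord card_bool -expnS => H.
(* The exponential bound becomes linear through [#|A| < 2 ^ #|A|]. *)
rewrite -(leq_exp2l _ _ (ltnSn 1)) expnM [#|A| * #|X|]mulnC.
by apply: leq_trans H _; rewrite leq_exp2r // ltnW // ltn_expl.
Qed.

(** * Linear bounds on the number of generators *)

Lemma card_near_const (L : signature) (A : algebra L) (n : nat) :
  0 < n -> #|near_const A n| <= #|A| * #|A| * n.
Proof.
move=> n0; pose i0 := Ordinal n0.
pose h (p : A * A * 'I_n) : power_alg A n := upd [ffun _ => p.1.1] p.2 p.1.2.
rewrite -[n in X in _ <= X]card_ord -!card_prod -cardsT.
apply: leq_trans (leq_imset_card h _); apply: subset_leq_card.
apply/subsetP=> v; rewrite inE => /existsP[c /forallP Hc].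
pose vf : {ffun 'I_n -> A} := v.
have [i Hi] : exists i, forall l, l != i -> vf l = c.
  have [/existsP[i Hi]|Hn] := boolP [exists i, vf i != c].
    exists i => l li; apply/eqP; apply: contraNT li => Hl.
    by have /forallP/(_ i) := Hc l; rewrite Hl Hi.
  (* A constant tuple has no exceptional place, so [i0] serves as a default. *)
  exists i0 => l _; apply/eqP; apply: contraNT Hn => Hl.
  by apply/existsP; exists l.
apply/imsetP; exists (c, vf i, i) => //.
by apply/ffunP=> l; rewrite ffunE; case: eqP => [->//|/eqP/Hi]; rewrite ffunE.
Qed.

Lemma d_gen_min (L : signature) (A : algebra L) (n : nat)
    (X : {set power_alg A n}) : generates X -> d_gen A n <= #|X|.
Proof.
move=> HX; rewrite /d_gen; case: ex_minnP => d _; apply.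
apply/existsP; exists X; rewrite eqxx /= /generatesb.
by case: excluded_middle_informative.
Qed.

Lemma d_gen_attained (L : signature) (A : algebra L) (n : nat) :
  exists X : {set power_alg A n}, generates X /\ #|X| = d_gen A n.
Proof.
rewrite /d_gen; case: ex_minnP => d /existsP[X /andP[/eqP Xd HX]] _; exists X.
by split=> //; move: HX; rewrite /generatesb; case: excluded_middle_informative.
Qed.

Lemma BigTheta_linear (f : nat -> nat) (a b c : nat) :
  (forall n, n <= a + b * f n) -> (forall n, 0 < n -> f n <= c * n) ->
  BigTheta f (fun n => n).
Proof.
move=> Hlow Hup.
(* Beyond [2 * a] the additive constant is absorbed: [2 * x <= x + 2 * b * f x]. The successors in
   [(2 * b).+1] and [c.+1] keep the constants positive. *)
pose N := INR (2 * a).+1.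
have HN : Rlt 0 N by apply: lt_0_INR; apply/ltP.
exists (Rinv (INR (2 * b).+1)), (INR c.+1), N.
split; first by apply: Rinv_0_lt_compat; apply: lt_0_INR; apply/ltP.
split; first by apply: lt_0_INR; apply/ltP.
split=> // x Hx; rewrite !Rabs_right; try exact/Rle_ge/pos_INR.
have /ltP x_big := INR_lt _ _ Hx.
split.
  have le_x : x <= (2 * b).+1 * f x.
    rewrite mulSn -mulnA; apply: leq_trans (leq_addl _ _).
    rewrite -(leq_add2l x) addnn -mul2n.
    apply: (leq_trans (n := 2 * (a + b * f x))); first by rewrite leq_mul2l Hlow.
    by rewrite mulnDr leq_add2r ltnW // ltnW.
  apply: (Rmult_le_reg_l (INR (2 * b).+1)); first by apply: lt_0_INR; apply/ltP.
  rewrite -Rmult_assoc Rinv_r ?Rmult_1_l; last by apply: not_0_INR.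
  by rewrite -mult_INR; apply: le_INR; apply/leP.
rewrite -mult_INR; apply: le_INR; apply/leP.
apply: leq_trans (Hup x (leq_ltn_trans (leq0n _) x_big)) _.
exact: leq_mul (leqnSn c) (leqnn x).
Qed.

Theorem theorem4p1 (L : signature) (A : algebra L) :
  1 < #|A| -> solvable A -> has_pointed_cube_term A ->
  BigTheta (d_gen A) (fun n => n) /\
  (forall n : nat, generates (near_const A n)).
Proof.
move=> HA Hsol Hcube.
have /card_gt0P[c _] : 0 < #|A| by apply: ltnW.
have Hgen n := near_const_generates (n := n) c Hsol Hcube.
split=> //; apply: (@BigTheta_linear _ #|A| (#|A| * #|A|) (#|A| * #|A|)) => n.
  have [X [HX <-]] := d_gen_attained A n.
  by have := generators_lower_bound HA Hsol Hcube HX; rewrite mulnS mulnA.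
by move=> n0; apply: leq_trans (d_gen_min (Hgen n)) (card_near_const A n0).
Qed.
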